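(* Let $k$ be a field of characteristic $p>0$ and let $G$ be an arbitrary finite $p$-group of order $p^n$. Then there is a trace-surjective $G$-subalgebra $U\le D_k$ (i.e. a $G$-stable $k$-subalgebra which is a trace-surjective $G$-algebra) such that the following hold: (i) $U$ is a polynomial ring over $k$ of Krull-dimension $n$ and a retract of $D_k$, i.e. $D_k=U\oplus I$ for some $G$-stable ideal $I\unlhd D_k$. (ii) $U$ can be constructed in such a way that $U=k[Y_0,\dots,Y_{n-1}]$ with ''triangular'' $G$-action: for every $g\in G$ and $i=0,\dots,n-1$ one has $(Y_i)g=Y_i+f_i(Y_{i+1},\dots,Y_{n-1})$ for some polynomial $f_i=f_{i,g}$ over $k$ in the variables $Y_{i+1},\dots,Y_{n-1}$ (depending on $g$). (iii) The ring of invariants $U^G$ is also a polynomial ring over $k$ of Krull-dimension $n$.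
   Context: All group actions are right actions. A $G$-algebra is a commutative $k$-algebra $A$ on which $G$ acts by $k$-algebra automorphisms; $A^G$ is the subring of $G$-fixed elements. The transfer (trace) map is $\mathrm{tr}:A\to A^G$, $a\mapsto\sum_{g\in G} ag$. A $G$-algebra $A$ is called trace-surjective if $\mathrm{tr}(A)=A^G$ (equivalently $1=\mathrm{tr}(a)$ for some $a\in A$). Let $V_{reg}=\bigoplus_{g\in G}kX_g$ be the regular right $kG$-module, with $(X_g)h=X_{gh}$. Define $D_k=D_k(G):=\mathrm{Sym}_k(V_{reg})/(\alpha)$ with $\alpha=-1+\sum_{g\in G}X_g$, with the induced $G$-action; with $x_g$ the image of $X_g$ it is a polynomial ring $k[x_g\mid 1\ne g\in G]$ of Krull-dimension $|G|-1$, with $\sum_{g\in G}x_g=1$ and $x_gh=x_{gh}$. *)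

(* Defs.v *)
From HB Require Import structures.
From mathcomp Require Import all_boot all_order all_algebra all_fingroup.
From mathcomp Require Import boolp.
From mathcomp Require Export mpoly.

Set Implicit Arguments.
Unset Strict Implicit.
Unset Printing Implicit Defensive.

Import GRing.Theory.
Local Open Scope ring_scope.
Local Open Scope quotient_scope.

Section GAlgebras.

Variables (k : fieldType) (G : finGroupType) (A : comAlgType k).
Variable to : {action G &-> A}.
Implicit Types (U I : {pred A}).

Definition Galgebra_action : Prop :=
  forall g : G, linear (to^~ g) /\ monoid_morphism (to^~ g).

Definition invariants : {pred A} := [pred x | [forall g : G, to x g == x]].

Definition transfer (a : A) : A := \sum_(g : G) to a g.

Definition Gstable U : Prop := forall g : G, {in U, forall x, to x g \in U}.

Definition Gsubalgebra U : Prop := subalg_closed U /\ Gstable U.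

Definition invariants_in U : {pred A} := [predI U & invariants].

Definition trace_surjective U : Prop :=
  forall x, x \in invariants_in U <-> exists2 a, a \in U & x = transfer a.

Definition is_ideal I : Prop :=
  0 \in I /\ forall a, {in I &, forall u v, a * u + v \in I}.

Definition direct_sum U I : Prop :=
  (forall x, exists u v, [/\ u \in U, v \in I & x = u + v])
  /\ (forall x, x \in U -> x \in I -> x = 0).

Definition Gretract U : Prop :=
  exists I, [/\ is_ideal I, Gstable I & direct_sum U I].

End GAlgebras.

Section PolynomialSubrings.

Variables (k : fieldType) (A : comAlgType k).
Implicit Type U : {pred A}.

Definition peval m (Y : 'I_m -> A) (f : {mpoly k[m]}) : A :=
  mmap (in_alg A) Y f.

(* U = k[Y_0, ..., Y_(m-1)] with the Y_i algebraically independent over k. *)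
Definition polynomial_generators m (Y : 'I_m -> A) U : Prop :=
  injective (peval Y) /\ forall x, x \in U <-> exists f, x = peval Y f.

Definition polynomial_ring U : Prop :=
  exists m, exists Y : 'I_m -> A, polynomial_generators Y U.

(* P is a prime ideal of the subring U, viewed as a subset of A. *)
Definition prime_ideal_in U (P : {pred A}) : Prop :=
  [/\ {subset P <= U},
      0 \in P /\ {in U & P &, forall a u v, a * u + v \in P},
      1 \notin P
    & {in U &, forall x y, x * y \in P -> x \in P \/ y \in P}].

(* Strict chains P 0 < P 1 < ... < P m of primes of U; terms of index > m
   are irrelevant. *)
Definition prime_chain U m (P : nat -> {pred A}) : Prop :=
  (forall i, (i <= m)%N -> prime_ideal_in U (P i))
  /\ (forall i, (i < m)%N ->
        {subset P i <= P i.+1} /\ exists2 x, x \in P i.+1 & x \notin P i).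

Definition krull_dim U d : Prop :=
  (exists P, prime_chain U d P)
  /\ (forall m P, prime_chain U m P -> (m <= d)%N).

End PolynomialSubrings.

Section TriangularAction.

Variables (k : fieldType) (G : finGroupType) (A : comAlgType k).
Variable to : {action G &-> A}.

(* Only the variables X_(i+1), ..., X_(n-1) occur in f. *)
Definition mvars_above n (i : 'I_n) (f : {mpoly k[n]}) : Prop :=
  forall m, m \in msupp f -> forall j : 'I_n, (j <= i)%N -> m j = 0%N.

Definition triangular_action n (Y : 'I_n -> A) : Prop :=
  forall (g : G) (i : 'I_n), exists2 f : {mpoly k[n]},
    mvars_above i f & to (Y i) g = Y i + peval Y f.

End TriangularAction.

Section Dk.

Variables (k : fieldType) (G : finGroupType).

(* Sym_k(V_reg), the polynomial ring on the basis (X_g) of V_reg, whose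
   variables are numbered along the enumeration of G. *)
Definition SymVreg := {mpoly k[#|G|]}.
HB.instance Definition _ := GRing.ComAlgebra.on SymVreg.

Definition Xvar (g : G) : SymVreg := 'X_(enum_rank g).

Definition Sym_act (f : SymVreg) (h : G) : SymVreg :=
  f \mPo [tuple Xvar (enum_val i * h)%g | i < #|G|].

Definition alpha : SymVreg := -1 + \sum_(g : G) Xvar g.

Definition alpha_ideal : {pred SymVreg} :=
  fun f => `[< exists q, f = q * alpha >].

Fact alpha_idealP f : reflect (exists q, f = q * alpha) (f \in alpha_ideal).
Proof. exact: asboolP. Qed.

Fact alpha_ideal_closed : idealr_closed alpha_ideal.
Proof.
split; first by apply/alpha_idealP; exists 0; rewrite mul0r.
  apply/alpha_idealP => -[q].
  move/(congr1 (meval (fun i : 'I_#|G| => (i == enum_rank (1%g : G))%:R))).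
  rewrite rmorphM rmorph1 /alpha rmorphD rmorphN rmorph1 rmorph_sum /=.
  rewrite (bigD1 1%g) //= mevalXU eqxx big1 ?addr0 ?addNr ?mulr0.
    by move/eqP; rewrite oner_eq0.
  by move=> g /negPf g1; rewrite mevalXU (inj_eq enum_rank_inj) g1.
move=> a _ _ /alpha_idealP[q ->] /alpha_idealP[r ->].
by apply/alpha_idealP; exists (a * q + r); rewrite mulrDl mulrA.
Qed.

HB.instance Definition _ :=
  isIdealr.Build SymVreg alpha_ideal alpha_ideal_closed.

Definition Dk := {ideal_quot alpha_ideal}.
HB.instance Definition _ := GRing.ComNzRing.on Dk.


Definition Dpi (f : SymVreg) : Dk := \pi_({ideal_quot alpha_ideal}) f.
Definition Drepr (x : Dk) : SymVreg :=
  generic_quotient.repr (x : {ideal_quot alpha_ideal}).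

Fact DreprK : cancel Drepr Dpi.
Proof. exact: reprK. Qed.

Fact DpiP f g : reflect (exists q, f - g = q * alpha) (Dpi f == Dpi g).
Proof. by rewrite -Quotient.idealrBE; apply: alpha_idealP. Qed.

HB.instance Definition _ := GRing.RMorphism.copy Dpi
  (\pi_({ideal_quot alpha_ideal}) : SymVreg -> {ideal_quot alpha_ideal}).

Definition Dk_scale (c : k) (x : Dk) : Dk := Dpi (c *: Drepr x).

Fact Dk_scale_pi c f : Dk_scale c (Dpi f) = Dpi (c *: f).
Proof.
have /eqP/DpiP[q e] := DreprK (Dpi f).
by apply/eqP/DpiP; exists (c *: q); rewrite -scalerBr e scalerAl.
Qed.

Fact Dk_scaleA a b x : Dk_scale a (Dk_scale b x) = Dk_scale (a * b) x.
Proof. by rewrite -(DreprK x) !Dk_scale_pi scalerA. Qed.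

Fact Dk_scale1 : left_id 1 Dk_scale.
Proof. by move=> x; rewrite -(DreprK x) Dk_scale_pi scale1r. Qed.

Fact Dk_scaleDr : right_distributive Dk_scale +%R.
Proof.
move=> a x y; rewrite -(DreprK x) -(DreprK y).
by rewrite -rmorphD !Dk_scale_pi scalerDr rmorphD.
Qed.

Fact Dk_scaleDl x : {morph Dk_scale^~ x : a b / a + b}.
Proof.
by move=> a b; rewrite -(DreprK x) !Dk_scale_pi scalerDl rmorphD.
Qed.

HB.instance Definition _ := GRing.Zmodule_isLmodule.Build k Dk
  Dk_scaleA Dk_scale1 Dk_scaleDr Dk_scaleDl.

Fact Dk_scaleAl (a : k) (x y : Dk) : a *: (x * y) = (a *: x) * y.
Proof.
rewrite -(DreprK x) -(DreprK y) -rmorphM ![_ *: Dpi _]Dk_scale_pi.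
by rewrite -rmorphM scalerAl.
Qed.

HB.instance Definition _ := GRing.Lmodule_isLalgebra.Build k Dk Dk_scaleAl.
HB.instance Definition _ := GRing.Lalgebra_isComAlgebra.Build k Dk.

Fact Sym_act_alpha h : Sym_act alpha h = alpha.
Proof.
rewrite /Sym_act /alpha rmorphD rmorphN rmorph1 rmorph_sum /=; congr (_ + _).
rewrite [RHS](reindex_inj (mulIg h)); apply: eq_bigr => g _.
by rewrite comp_mpolyXU -tnth_nth tnth_mktuple enum_rankK.
Qed.

(* The induced action; it does not depend on the representative, see
   [Dk_act_pi]. *)
Definition Dk_act_fun (x : Dk) (h : G) : Dk := Dpi (Sym_act (Drepr x) h).

Fact Dk_act_pi f h : Dk_act_fun (Dpi f) h = Dpi (Sym_act f h).
Proof.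
have /eqP/DpiP[q e] := DreprK (Dpi f).
apply/eqP/DpiP; exists (Sym_act q h).
rewrite -[X in _ = _ * X](Sym_act_alpha h) /Sym_act -rmorphM -e.
by rewrite rmorphB.
Qed.

Fact Sym_act1 f : Sym_act f 1%g = f.
Proof.
rewrite -[RHS]comp_mpoly_id /Sym_act; congr comp_mpoly.
by apply: eq_mktuple => i; rewrite mulg1 /Xvar enum_valK.
Qed.

Fact Sym_actM f g h : Sym_act f (g * h)%g = Sym_act (Sym_act f g) h.
Proof.
rewrite {1}/Sym_act [_ \mPo _]comp_mpolyEX {2}/Sym_act comp_mpolyEX.
rewrite /Sym_act raddf_sum /=; apply: eq_bigr => m _.
rewrite comp_mpolyZ; congr (_ *: _).
rewrite !comp_mpolyX rmorph_prod /=; apply: eq_bigr => i _.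
rewrite rmorphXn /= !tnth_mktuple comp_mpolyXU -tnth_nth tnth_mktuple.
by rewrite enum_rankK mulgA.
Qed.

Fact Dk_act1 x : Dk_act_fun x 1%g = x.
Proof. by rewrite /Dk_act_fun Sym_act1 DreprK. Qed.

Fact Dk_actM x : act_morph Dk_act_fun x.
Proof.
by move=> g h; rewrite -(DreprK x) !Dk_act_pi Sym_actM.
Qed.

Definition Dk_act : {action G &-> Dk} := TotalAction Dk_act1 Dk_actM.

Fact Dk_act_Galgebra : Galgebra_action Dk_act.
Proof.
move=> h; split=> [c x y|]; last split=> [|x y].
- rewrite -(DreprK x) -(DreprK y) [_ *: Dpi _]Dk_scale_pi -rmorphD /= !Dk_act_pi.
  by rewrite [_ *: Dpi _]Dk_scale_pi -rmorphD /= /Sym_act linearP.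
- by rewrite /= -(rmorph1 Dpi) Dk_act_pi /Sym_act comp_mpoly1.
- rewrite -(DreprK x) -(DreprK y) -rmorphM /= !Dk_act_pi.
  by rewrite -rmorphM /= /Sym_act rmorphM.
Qed.

Definition xgen (g : G) : Dk := Dpi (Xvar g).

Fact xgen_act g h : Dk_act (xgen g) h = xgen (g * h)%g.
Proof.
rewrite /= Dk_act_pi /xgen /Sym_act comp_mpolyXU -tnth_nth tnth_mktuple.
by rewrite enum_rankK.
Qed.

Fact sum_xgen : \sum_(g : G) xgen g = 1.
Proof.
rewrite -rmorph_sum -(rmorph1 Dpi) /=; apply/eqP/DpiP; exists 1.
by rewrite mul1r addrC.
Qed.

End Dk.

(* Main.v *)
Require Import Defs.
From HB Require Import structures.
From mathcomp Require Import all_boot all_order all_algebra all_fingroup.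
From mathcomp Require Import cyclic pgroup center nilpotent sylow.
From mathcomp Require Import boolp ring.

Set Implicit Arguments.
Unset Strict Implicit.
Unset Printing Implicit Defensive.

Import GRing.Theory.
Local Open Scope ring_scope.

(** A finite p-group G acts on affine n-space by a triangular action that looks
   like translations: there are a right action on k['X_0, ..., 'X_(n-1)] and
   polynomials in the later variables by which each g translates 'X_i. It is
   built one variable at a time. Let z be central of order p; a model for
   G / <[z]> has an element of trace 1, so its ring is acyclic and the
   homomorphism z ^+ m |-> m extends to a cocycle of G with values in it. The
   new variable is translated by this cocycle ([triangular_model_extension]).

   Two facts are read off from traces. The trace over <[z]> of a polynomial in
   the new variable is its sum over the translates by the prime field, which is
   constant when the degree is less than p; hence the trace over G of a product
   of such one-variable polynomials is a scalar. First, with delta the product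
   of the 1 - 'X_i ^+ (p - 1), which on the points of the prime field is the
   indicator function of the origin, delta has trace 1 and each 'X_i * delta
   has trace 0. Secondly, the Frobenius map turns the translation cocycle into
   a coboundary after subtracting the cocycle itself, which gives invariants
   tau_i = 'X_i ^+ p - 'X_i - u_i with u_i in the later variables. Every
   polynomial is a combination of monomials with exponents less than p over
   k[tau], and the invariants, being traces, lie in k[tau]
   ([model_invariant_generators]).

   As D_k has the element x_1 of trace 1, the cocycles of the model split in
   D_k, which yields an equivariant map iota from the model to D_k
   ([model_versal]), and x_g |-> delta.g defines an equivariant map theta
   backwards. The splitting being y_i = - sum_g (translation of y_i by g) x_g,
   the two traces above say precisely that theta maps y_i to 'X_i. Thus
   theta \o iota is the identity, U is the image of iota and the kernel of theta
   is the complementary ideal.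

   The Krull dimension of a polynomial ring in n variables is at most n because
   any n + 1 of its elements are algebraically dependent, and a relation among
   elements chosen along a chain of n + 2 primes can be shortened step by step
   until it puts a nonzero scalar into the last prime
   ([prime_chain_length]). *)

(** * Evaluation of polynomials and triangular systems *)

Section Evaluation.

Variables (k : fieldType) (A : comAlgType k) (n : nat).
Implicit Types (Y Z : 'I_n -> A) (f : {mpoly k[n]}).

HB.instance Definition _ Y := GRing.RMorphism.copy (peval Y)
  (mmap (in_alg A) Y : {mpoly k[n]} -> A).

Fact peval_is_scalable Y : scalable (peval Y).
Proof. by move=> c f; rewrite /peval mmapZ /= -scalerAl mul1r. Qed.

HB.instance Definition _ Y := GRing.isScalable.Build k {mpoly k[n]} A *:%R
  (peval Y) (peval_is_scalable Y).

Lemma pevalX Y m : peval Y 'X_[m] = \prod_i Y i ^+ m i.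
Proof. exact: mmapX. Qed.

Lemma pevalXU Y i : peval Y 'X_i = Y i.
Proof. by rewrite /peval mmapX mmap1U. Qed.

Lemma eq_peval Y Z f : Y =1 Z -> peval Y f = peval Z f.
Proof.
by move=> eqYZ; rewrite /peval /mmap; apply: eq_bigr => m _; rewrite (mmap1_eq _ eqYZ).
Qed.

Lemma peval_above i Y Z f : mvars_above i f ->
  (forall j : 'I_n, (i < j)%N -> Y j = Z j) -> peval Y f = peval Z f.
Proof.
move=> fP eqYZ; rewrite /peval /mmap big_seq [RHS]big_seq.
apply: eq_bigr => m mf; congr (_ * _); apply: eq_bigr => j _.
have [ij | ji] := ltnP i j; first by rewrite eqYZ.
by rewrite (fP _ mf).
Qed.

End Evaluation.

Lemma lrmorph_peval (k : fieldType) (A B : comAlgType k)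
    (phi : {lrmorphism A -> B}) n (Y : 'I_n -> A) (f : {mpoly k[n]}) :
  phi (peval Y f) = peval (phi \o Y) f.
Proof.
elim/mpolyind: f => [|c m f _ _ IHf]; first by rewrite !rmorph0.
rewrite !rmorphD /= !linearZ /= IHf !pevalX rmorph_prod.
by congr (_ *: _ + _); apply: eq_bigr => i _ /=; rewrite rmorphXn.
Qed.

Lemma peval_id (k : fieldType) n (f : {mpoly k[n]}) :
  peval (fun i => 'X_i) f = f.
Proof.
elim/mpolyind: f => [|c m f _ _ IHf]; first by rewrite rmorph0.
by rewrite rmorphD /= linearZ /= IHf pevalX -mpolyXE_id.
Qed.

Lemma peval_peval (k : fieldType) (A : comAlgType k) m n (Y : 'I_n -> A)
    (Z : 'I_m -> {mpoly k[n]}) f :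
  peval Y (peval Z f) = peval (fun i => peval Y (Z i)) f.
Proof. exact: lrmorph_peval. Qed.

Section VariablesAbove.

Variables (k : fieldType) (n : nat) (i : 'I_n).
Implicit Types f g : {mpoly k[n]}.

Lemma mvars_aboveD f g :
  mvars_above i f -> mvars_above i g -> mvars_above i (f + g).
Proof.
move=> fP gP m /msuppD_le; rewrite mem_cat => /orP[mf|mg] j ji.
  exact: fP mf _ ji.
exact: gP mg _ ji.
Qed.

Lemma mvars_aboveZ c f : mvars_above i f -> mvars_above i (c *: f).
Proof. by move=> fP m /msuppZ_le mf; apply: fP. Qed.

Lemma mvars_aboveM f g :
  mvars_above i f -> mvars_above i g -> mvars_above i (f * g).
Proof.
move=> fP gP m /msuppM_le/allpairsP[[m1 m2] /= [mf mg ->]] j ji.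
by rewrite mnmDE (fP _ mf) ?(gP _ mg).
Qed.

Lemma mvars_above0 : mvars_above i (0 : {mpoly k[n]}).
Proof. by move=> m; rewrite msupp0. Qed.

Lemma mvars_above1 : mvars_above i (1 : {mpoly k[n]}).
Proof. by move=> m; rewrite msupp1 inE => /eqP-> j _; rewrite mnm0E. Qed.

Lemma mvars_aboveX (j : 'I_n) :
  (i < j)%N -> mvars_above i ('X_j : {mpoly k[n]}).
Proof.
move=> ij m; rewrite msuppX inE => /eqP-> l li; rewrite mnm1E.
by case: eqP => // ejl; move: ij; rewrite ejl ltnNge li.
Qed.

Lemma mvars_above_peval m (Y : 'I_m -> {mpoly k[n]}) (f : {mpoly k[m]}) :
  (forall e, e \in msupp f -> forall j, e j != 0%N -> mvars_above i (Y j)) ->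
  mvars_above i (peval Y f).
Proof.
move=> YP; rewrite /peval /mmap big_seq.
apply: big_ind => [||e ef]; [exact: mvars_above0 | exact: mvars_aboveD |].
rewrite -scalerAl mul1r; apply: mvars_aboveZ.
apply: big_ind => [||j _]; [exact: mvars_above1 | exact: mvars_aboveM |].
have [-> | ej] := eqVneq (e j) 0%N; first exact: mvars_above1.
elim: (e j) => [|d IHd]; first exact: mvars_above1.
by rewrite exprS; apply: mvars_aboveM => //; apply: YP ej.
Qed.

End VariablesAbove.

Lemma ord_descending_ind n (P : 'I_n -> Prop) :
  (forall i : 'I_n, (forall j : 'I_n, (i < j)%N -> P j) -> P i) ->
  forall i, P i.
Proof.
move=> step i; have [d] := ubnP (n - i); elim: d i => // d IHd i id.
apply: step => j ij; apply: IHd; rewrite ltnS in id.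
by apply: leq_trans id; apply: ltn_sub2l.
Qed.

(** Iterating a triangular system n times from an arbitrary start stabilises,
   since the m-th iterate is already correct on the last m coordinates. *)
Lemma triangular_fixpoint n (X : Type) (x0 : X)
    (F : 'I_n -> ('I_n -> X) -> X) :
  (forall (i : 'I_n) y z, (forall j : 'I_n, (i < j)%N -> y j = z j) -> F i y = F i z) ->
  exists y, forall i, y i = F i y.
Proof.
move=> triF; pose it m := iter m (fun y i => F i y) (fun=> x0).
exists (it n) => i.
suffices: forall m (j : 'I_n), (n - m <= j)%N -> it m.+1 j = it m j.
  by move/(_ n i) => /= ->; rewrite ?subnn.
elim=> [|m IHm] j; first by rewrite subn0 leqNgt ltn_ord.
move=> mj; apply: triF => l jl; apply: IHm; apply: leq_trans jl.
by move: mj; rewrite !leq_subLR addSnnS.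
Qed.

(** * Krull dimension of polynomial rings *)

Lemma linear_dependence (k : fieldType) (E B : finType) (v : E -> B -> k) :
  (#|B| < #|E|)%N ->
  exists c : E -> k, (exists e, c e != 0) /\ forall b, \sum_e c e * v e b = 0.
Proof.
move=> ltBE.
pose M := \matrix_(i < #|E|, j < #|B|) v (enum_val i) (enum_val j).
have kerM : kermx M != 0.
  rewrite -mxrank_eq0 mxrank_ker subn_eq0 -ltnNge.
  exact: leq_ltn_trans (rank_leq_col M) ltBE.
have /rowV0Pn[u /sub_kermxP uM /rV0Pn[i ui]] := kerM.
exists (fun e => u 0 (enum_rank e)); split.
  by exists (enum_val i); rewrite enum_valK.
move=> b; have := congr1 (fun X : 'rV_#|B| => X 0 (enum_rank b)) uM.
rewrite !mxE => {2}<-; rewrite (reindex _ (onW_bij _ (@enum_val_bij E))) /=.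
by apply: eq_bigr => j _; rewrite mxE enum_valK enum_rankK.
Qed.

Definition exponents_le (k : fieldType) n d (f : {mpoly k[n]}) : Prop :=
  forall m, m \in msupp f -> forall i, (m i <= d)%N.

Lemma exponents_leM (k : fieldType) n d1 d2 (f g : {mpoly k[n]}) :
  exponents_le d1 f -> exponents_le d2 g -> exponents_le (d1 + d2) (f * g).
Proof.
move=> fP gP m /msuppM_le/allpairsP[[m1 m2] /= [mf mg ->]] i.
by rewrite mnmDE leq_add ?fP ?gP.
Qed.

Lemma exponents_le1 (k : fieldType) n : exponents_le 0 (1 : {mpoly k[n]}).
Proof. by move=> m; rewrite msupp1 inE => /eqP-> i; rewrite mnm0E. Qed.

Lemma exponents_le_prod (k : fieldType) n m d (f : 'I_m -> {mpoly k[n]})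
    (e : 'I_m -> nat) :
  (forall i, exponents_le d (f i)) ->
  exponents_le (\sum_i e i * d) (\prod_i f i ^+ e i).
Proof.
move=> fP; elim/big_rec2: _ => [|i d' g _ gP]; first exact: exponents_le1.
apply: exponents_leM => //; elim: (e i) => [|a IHa]; first exact: exponents_le1.
by rewrite mulSn exprS; apply: exponents_leM.
Qed.

Lemma exponents_le_bound (k : fieldType) n (f : {mpoly k[n]}) :
  exponents_le (msize f) f.
Proof.
move=> m /msize_mdeg_lt mf i; apply: leq_trans (ltnW mf).
by rewrite mdegE (bigD1 i) //= leq_addr.
Qed.

(** By counting: the products of powers of the f i with exponents less than N
   are N^(n+1) many, whereas the monomials in the n variables that occur in these
   products number at most a constant times N^n. *)
Lemma algebraic_dependence (k : fieldType) n (f : 'I_n.+1 -> {mpoly k[n]}) :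
  exists N (c : {ffun 'I_n.+1 -> 'I_N} -> k),
    (exists e, c e != 0) /\ \sum_e c e *: \prod_i f i ^+ e i = 0.
Proof.
pose D := (\max_i msize (f i))%N.
pose C := (n.+1 * D).+1; pose N := (C ^ n).+1; pose M := (n.+1 * (N * D)).+1.
have fD i : exponents_le D (f i).
  by move=> m mf j; apply: leq_trans (exponents_le_bound mf j) (leq_bigmax i).
pose mon (b : {ffun 'I_n -> 'I_M}) := [multinom (b i : nat) | i < n].
have [|c [c0 cP]] := @linear_dependence k {ffun 'I_n.+1 -> 'I_N}
    {ffun 'I_n -> 'I_M} (fun e b => (\prod_i f i ^+ e i)@_(mon b)).
  rewrite !card_ffun !card_ord expnSr.
  have MC : (M <= N * C)%N.
    by rewrite /M /C mulnS mulnCA -addn1 addnC leq_add.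
  have leqX a b d : (a <= b)%N -> (a ^ d <= b ^ d)%N.
    by case: d => // d; rewrite leq_exp2r.
  apply: leq_ltn_trans (leqX _ _ _ MC) _.
  by rewrite expnMn ltn_pmul2l ?expn_gt0.
exists N, c; split=> //; apply/mpolyP => m; rewrite mcoeff0 raddf_sum /=.
under eq_bigr do rewrite mcoeffZ.
have [mM | /forallPn[i mi]] := boolP [forall i, m i < M]%N.
  have -> : m = mon [ffun i => Ordinal (forallP mM i)].
    by apply/mnmP => i; rewrite mnmE ffunE.
  exact: cP.
apply: big1 => e _; apply/eqP; rewrite mulf_eq0 mcoeff_eq0; apply/orP; right.
apply: contra mi => me; rewrite ltnS.
apply: leq_trans (exponents_le_prod (e := fun i => e i : nat) fD me i) _.
apply: (@leq_trans (\sum_(j < n.+1) N * D)%N).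
  by apply: leq_sum => j _; rewrite leq_mul2r (ltnW (ltn_ord _)) orbT.
by rewrite sum_nat_const card_ord.
Qed.

Section KrullDimension.

Variables (k : fieldType) (A : comAlgType k) (U : {pred A}) (n : nat).
Variable Y : 'I_n -> A.
Hypothesis UY : polynomial_generators Y U.

Lemma polynomial_generators_subalg : subalg_closed U.
Proof.
split=> [|a u v /UY.2[f ->] /UY.2[g ->]|u v /UY.2[f ->] /UY.2[g ->]]; apply/UY.2.
- by exists 1; rewrite rmorph1.
- by exists (a *: f + g); rewrite linearP.
- by exists (f * g); rewrite rmorphM.
Qed.

(** Pick x_i in P_(i+1) but not in P_i and a polynomial relation between
   x_0, ..., x_n. Divide it by the smallest power of x_0 that occurs, which is
   legitimate modulo the prime P_0; modulo P_1 only the terms without x_0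
   survive, so that a relation between x_1, ..., x_n in P_1 remains, whose
   coefficients are among the original ones. Repeating this leads to a nonzero
   scalar in P_(n+1). *)
Lemma prime_chain_length m (P : nat -> {pred A}) :
  prime_chain U m P -> (m <= n)%N.
Proof.
move=> [primeP ltP]; rewrite leqNgt; apply/negP => nm.
have [x xP] : exists x : 'I_n.+1 -> A,
    forall i, x i \in P i.+1 /\ x i \notin P i.
  apply: (@fin_all_exists _ (fun=> A)
    (fun (i : 'I_n.+1) a => a \in P i.+1 /\ a \notin P i)) => i.
  by have [_ [a aP aP']] := ltP i (leq_trans (ltn_ord i) nm); exists a.
have xU i : x i \in U.
  have [sPU _ _ _] := primeP i.+1 (leq_trans (ltn_ord i) nm).
  exact: sPU (xP i).1.
have [f fx] : exists f : 'I_n.+1 -> {mpoly k[n]}, forall i, x i = peval Y (f i).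
  by apply: (@fin_all_exists _ (fun=> {mpoly k[n]})
       (fun i g => x i = peval Y g)) => i; apply/UY.2.
have [N [c [[e0 ce0] cP]]] := algebraic_dependence f.
pose term j (e : {ffun 'I_n.+1 -> 'I_N}) :=
  \prod_(i < n.+1 | (j <= i)%N) x i ^+ e i.
have termU j e : term j e \in U.
  rewrite [term j e](_ : _ = peval Y (\prod_(i < n.+1 | (j <= i)%N) f i ^+ e i)).
    by apply/UY.2; eexists.
  by rewrite rmorph_prod; apply: eq_bigr => i _; rewrite rmorphXn fx.
(* The exponents in S agree at the first j places: they are those that are
   lexicographically smallest there. *)
have descend j : (j <= n.+1)%N -> exists S : {set {ffun 'I_n.+1 -> 'I_N}},
    [/\ S != set0, {in S, forall e, c e != 0},
        forall e e', e \in S -> e' \in S -> forall i : 'I_n.+1, (i < j)%N -> e i = e' i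
      & \sum_(e in S) c e *: term j e \in P j].
  elim: j => [|j IHj] jn.
    exists [set e | c e != 0]; split=> //.
    - by apply/set0Pn; exists e0; rewrite inE.
    - by move=> e; rewrite inE.
    have [_ [P0 _] _ _] := primeP 0%N isT.
    rewrite [X in X \in _](_ : _ = 0) //.
    rewrite -[RHS](rmorph0 (peval Y)) -cP rmorph_sum /=.
    rewrite [RHS](bigID (fun e => e \in [set e | c e != 0])) /= [X in _ = _ + X]big1 ?addr0.
      apply: eq_bigr => e _; rewrite linearZ rmorph_prod /=; congr (_ *: _).
      by apply: eq_big => // i _; rewrite rmorphXn fx.
    by move=> e; rewrite inE negbK => /eqP->; rewrite scale0r rmorph0.
  have [S [/set0Pn[e1 e1S] cS eqS sumS]] := IHj (ltnW jn).
  pose oj := Ordinal jn; pose d (e : {ffun 'I_n.+1 -> 'I_N}) : nat := e oj.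
  pose e2 := [arg min_(e < e1 in S) d e].
  have [e2S e2min] : e2 \in S /\ {in S, forall e, (d e2 <= d e)%N}.
    by rewrite /e2; case: arg_minnP => // e eS emin.
  exists [set e in S | d e == d e2]; split.
  - by apply/set0Pn; exists e2; rewrite inE e2S eqxx.
  - by move=> e; rewrite inE => /andP[eS _]; apply: cS.
  - move=> e e'; rewrite !inE => /andP[eS /eqP de] /andP[e'S /eqP de'] i.
    rewrite ltnS leq_eqVlt => /orP[/eqP ij|]; last exact: (eqS e e').
    have -> : i = oj by apply: val_inj.
    by apply: val_inj; rewrite /= -/(d e) -/(d e') de.
  have [U1 UZ UM] := polynomial_generators_subalg.
  have [sPU [Pj0 PjM] _ Pj_prime] := primeP j (leq_trans (ltnW jn) nm).
  have [sPU' [P0 PM] _ _] := primeP j.+1 (leq_trans jn nm).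
  have [sPP _] := ltP j (leq_trans jn nm).
  have [xoj xoj'] := xP oj.
  have termE e : term j e = x oj ^+ d e * term j.+1 e.
    rewrite /term (bigD1 oj) //=; congr (_ * _); apply: eq_bigl => i.
    by rewrite [RHS]ltn_neqAle -val_eqE /= eq_sym andbC.
  have U0 : 0 \in U by exact: sPU.
  have UZ0 a u : u \in U -> a *: u \in U.
    by move=> uU; rewrite -[_ *: _]addr0; apply: UZ.
  have Usum (I : finType) (Q : pred I) F :
      (forall i, Q i -> F i \in U) -> \sum_(i | Q i) F i \in U.
    move=> FU; elim/big_rec: _ => // i u Qi uU.
    by rewrite -[F i]scale1r; apply: UZ; rewrite ?FU.
  have UXM a v : v \in U -> x oj ^+ a * v \in U.
    by move=> vU; elim: a => [|a IHa]; rewrite ?mul1r // exprS -mulrA UM.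
  pose g := \sum_(e in S | d e == d e2) c e *: term j.+1 e.
  pose h := \sum_(e in S | d e != d e2)
    c e *: (x oj ^+ (d e - d e2).-1 * term j.+1 e).
  have gU : g \in U by apply: Usum => e _; apply: UZ0.
  have hU : h \in U by apply: Usum => e _; apply/UZ0/UXM.
  have sumE : \sum_(e in S) c e *: term j e = x oj ^+ d e2 * (g + x oj * h).
    rewrite (bigID (fun e => d e == d e2)) /= mulrDr; congr (_ + _).
      rewrite mulr_sumr; apply: eq_bigr => e /andP[_ /eqP de].
      by rewrite termE de scalerAr.
    rewrite mulrA -exprSr mulr_sumr; apply: eq_bigr => e /andP[eS de].
    rewrite termE -scalerAr mulrA -exprD; congr (_ *: (_ ^+ _ * _)).
    have lt_de : (d e2 < d e)%N by rewrite ltn_neqAle eq_sym de e2min.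
    by rewrite -[in RHS]addn1 -addnA add1n prednK ?subn_gt0 // subnKC // ltnW.
  have divX a w : w \in U -> x oj ^+ a * w \in P j -> w \in P j.
    move=> wU; elim: a => [|a IHa]; first by rewrite mul1r.
    rewrite exprS -mulrA => /Pj_prime[]; rewrite ?UXM //.
    by rewrite (negPf xoj').
  have ghU : g + x oj * h \in U by rewrite -[g]scale1r UZ ?UM.
  have ghP : g + x oj * h \in P j.+1.
    by apply/sPP/(divX (d e2)) => //; rewrite -sumE.
  rewrite (eq_bigl (fun e => (e \in S) && (d e == d e2))); last first.
    by move=> e; rewrite inE.
  rewrite -/g -[g](_ : - h * x oj + (g + x oj * h) = _); last first.
    by rewrite mulNr [x oj * h]mulrC addrC addrK.
  by apply: PM; rewrite // -scaleN1r UZ0.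
have [S [/set0Pn[e1 e1S] cS eqS]] := descend _ (leqnn _).
rewrite (big_pred1 e1) => [|e]; last first.
  apply/idP/eqP => [eS | -> //].
  by apply/ffunP => i; apply: eqS.
rewrite /term big1 => [|i]; last by rewrite leqNgt ltn_ord.
have [U1 UZ UM] := polynomial_generators_subalg.
have [sPU [P0 PM] P1 _] := primeP n.+1 nm.
move=> cP1; case/negP: P1; rewrite -[1](_ : (c e1)^-1%:A * (c e1)%:A + 0 = _); last first.
  by rewrite addr0 -scalerAl mul1r scalerA mulVf ?cS ?scale1r.
by apply: PM => //; rewrite -[_%:A]addr0 UZ // sPU.
Qed.

Lemma krull_dim_polynomial : krull_dim U n.
Proof.
split; last exact: prime_chain_length.
(* P i is the ideal generated by the Y j with j < i. *)
pose kill i (j : 'I_n) : {mpoly k[n]} := if (j < i)%N then 0 else 'X_j.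
have killS i f : peval (kill i.+1) (peval (kill i) f) = peval (kill i.+1) f.
  rewrite peval_peval; apply: eq_peval => j; rewrite /kill.
  case: ltnP => ji; last by rewrite pevalXU.
  by rewrite rmorph0 (leq_trans ji).
pose P i : {pred A} :=
  fun a => `[< exists2 f, a = peval Y f & peval (kill i) f = 0 >].
have PP i a : reflect (exists2 f, a = peval Y f & peval (kill i) f = 0) (a \in P i).
  exact: asboolP.
exists P; split=> [i _ | i ni].
  split.
  - by move=> a /PP[f -> _]; apply/UY.2; exists f.
  - split; first by apply/PP; exists 0; rewrite ?rmorph0.
    move=> a u v /UY.2[f ->] /PP[g -> g0] /PP[h -> h0]; apply/PP.
    exists (f * g + h); first by rewrite rmorphD rmorphM.
    by rewrite rmorphD rmorphM /= g0 h0 mulr0 addr0.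
  - apply/PP => -[f]; rewrite -[1](rmorph1 (peval Y)) => /UY.1<-.
    by rewrite rmorph1 => /eqP; rewrite oner_eq0.
  - move=> u v /UY.2[f ->] /UY.2[g ->] /PP[h].
    rewrite -rmorphM => /UY.1<- /eqP; rewrite rmorphM mulf_eq0.
    by case/orP => /eqP fg0; [left | right]; apply/PP; eexists.
split=> [a /PP[f -> f0]|].
  by apply/PP; exists f; rewrite // -killS f0 rmorph0.
pose oi := Ordinal ni; exists (Y oi).
  apply/PP; exists 'X_oi; first by rewrite pevalXU.
  by rewrite pevalXU /kill /= ltnSn.
apply/PP => -[f]; rewrite -(pevalXU Y) => /UY.1<-.
by rewrite pevalXU /kill ltnn => /eqP; rewrite -msize_poly_eq0 msizeX.
Qed.

End KrullDimension.

(** * Triangular systems of Artin-Schreier polynomials *)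

Section ArtinSchreier.

Variables (k : fieldType) (p n : nat) (u : 'I_n -> {mpoly k[n]}).
Hypothesis p_gt1 : (1 < p)%N.
Hypothesis u_above : forall i, mvars_above i (u i).

Definition artin_schreier (i : 'I_n) : {mpoly k[n]} := 'X_i ^+ p - 'X_i - u i.

Let tau := artin_schreier.

(** Replacing each variable by a power of itself that grows fast enough as the
   index decreases, the term 'X_i ^+ p dominates tau i, so that distinct
   monomials in the tau i have distinct leading monomials. *)
Lemma artin_schreier_independent : injective (peval tau).
Proof.
(* The weight of 'X_i exceeds the degree of u i after the substitution, which
   only involves weights of later variables. *)
have [W WE] : exists W : 'I_n -> nat,
    forall i, W i = (msize (peval (fun j => 'X_j ^+ W j) (u i))).+1.
  apply: (triangular_fixpoint 0%N
    (F := fun i W => (msize (peval (fun j => 'X_j ^+ W j) (u i))).+1)) => i W W' eqW.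
  congr (msize _).+1; apply: peval_above (@u_above i) _ => j ij.
  by rewrite eqW.
have W_gt0 i : (0 < W i)%N by rewrite WE.
have p_gt0 := ltnW p_gt1.
have Wp_gt0 i : (0 < W i * p)%N by rewrite muln_gt0 W_gt0.
pose sigma := peval (fun j => 'X_j ^+ W j : {mpoly k[n]}).
have sigma_tau i : mlead (sigma (tau i)) = (U_(i) *+ (W i * p))%MM.
  rewrite /tau /artin_schreier /sigma !rmorphB rmorphXn /= !pevalXU -exprM.
  have XnE a : 'X_i ^+ a = 'X_[k, U_(i) *+ a] by rewrite mpolyXn.
  have leadX : mlead ('X_i ^+ (W i * p) - 'X_i ^+ W i : {mpoly k[n]})
      = (U_(i) *+ (W i * p))%MM.
    rewrite mleadDl ?mleadN !XnE !mleadXm // lt_mdeg_ltmc // !mdegMn mdeg1 !mul1n.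
    by rewrite ltn_Pmulr.
  rewrite mleadDl leadX // mleadN lt_mdeg_ltmc //.
  rewrite mdegMn mdeg1 mul1n.
  set v := peval _ (u i); have [-> | v0] := eqVneq v 0.
    by rewrite mlead0 mdeg0.
  have -> : (mdeg (mlead v)).+1 = msize v by exact: mlead_deg.
  apply: (@leq_trans (W i)); first by rewrite WE leqnSn.
  by rewrite leq_pmulr // ltnW.
have sigma_tau0 i : sigma (tau i) != 0.
  apply/eqP => tau0; have := sigma_tau i; rewrite tau0 mlead0 => /mnmP/(_ i).
  rewrite mnm0E mulmnE mnm1E eqxx mul1n => /esym/eqP.
  by rewrite eqn0Ngt Wp_gt0.
pose L (m : 'X_{1..n}) := (\sum_i U_(i) *+ (W i * p) *+ m i)%MM.
have LE m i : L m i = (W i * p * m i)%N.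
  rewrite mnm_sumE (bigD1 i) //= big1 ?addn0.
    by rewrite !mulmnE mnm1E eqxx mul1n.
  by move=> j ji; rewrite !mulmnE mnm1E (negPf ji) !mul0n.
have L_inj : injective L.
  move=> m m' eqL; apply/mnmP => i; move/mnmP: eqL => /(_ i); rewrite !LE.
  by move/eqP; rewrite eqn_pmul2l // => /eqP.
apply: raddf_inj => f f0; apply/eqP; apply: contraT => nz_f.
have sigma_f : \sum_(m <- msupp f) f@_m *: \prod_i sigma (tau i) ^+ m i = 0.
  transitivity (sigma (peval tau f)); last by rewrite f0 /sigma rmorph0.
  rewrite [in RHS]/sigma peval_peval [in RHS]/peval /mmap; apply: eq_bigr => m _.
  by rewrite -scalerAl mul1r.
have leadL m : m \in msupp f -> mlead (f@_m *: \prod_i sigma (tau i) ^+ m i) = L m.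
  move=> mf; rewrite mleadZ -?mcoeff_msupp // mlead_prod; last first.
    by move=> i _ _; rewrite expf_neq0.
  by apply: eq_bigr => i _; rewrite mleadX // sigma_tau.
have supp0 m : m \in msupp f -> m = 0%MM.
  move=> mf; apply: (L_inj); transitivity (0%MM : 'X_{1..n}); last first.
    by apply/mnmP => i; rewrite LE !mnm0E muln0.
  apply/eqP; rewrite -Order.BPOrderTheory.lex0.
  have := congr1 (@mlead _ _) sigma_f; rewrite mlead_sum; last first.
    rewrite filter_predT (eq_in_map _ L _).1 //.
    by rewrite (map_inj_uniq L_inj); apply: msupp_uniq.
  rewrite mlead0 => joinE; change (L m <= (0%MM : 'X_{1..n}))%O.
  rewrite -joinE -(leadL _ mf).
  exact: (Order.BJoinTheory.joins_sup_seq (fun m => mlead _)).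
have fE : peval tau f = f.
  rewrite -[RHS]peval_id /peval /mmap big_seq [RHS]big_seq.
  by apply: eq_bigr => m /supp0 ->; rewrite !mmap11.
by move: nz_f; rewrite -fE f0 eqxx.
Qed.

Definition reduced_monomial (e : {ffun 'I_n -> 'I_p}) : {mpoly k[n]} :=
  \prod_i 'X_i ^+ e i.

Definition reduced_span (f : {mpoly k[n]}) : Prop :=
  exists s : seq ({mpoly k[n]} * {ffun 'I_n -> 'I_p}),
    f = \sum_(c <- s) peval tau c.1 * reduced_monomial c.2.

Lemma reduced_spanD f g :
  reduced_span f -> reduced_span g -> reduced_span (f + g).
Proof. by move=> [s ->] [t ->]; exists (s ++ t); rewrite big_cat. Qed.

Lemma reduced_span_tau c f : reduced_span f -> reduced_span (peval tau c * f).
Proof.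
move=> [s ->]; exists [seq (c * d.1, d.2) | d <- s].
rewrite big_map mulr_sumr; apply: eq_bigr => d _.
by rewrite /= rmorphM mulrA.
Qed.

Lemma reduced_span_monomial e : reduced_span (reduced_monomial e).
Proof. by exists [:: (1, e)]; rewrite big_seq1 /= rmorph1 mul1r. Qed.

Lemma reduced_spanZ c f : reduced_span f -> reduced_span (c *: f).
Proof.
move=> /(reduced_span_tau c%:MP); rewrite -mul_mpolyC; congr (reduced_span (_ * _)).
by rewrite -[c%:MP]mulr1 mul_mpolyC linearZ /= rmorph1.
Qed.

Lemma reduced_span0 : reduced_span 0.
Proof. by exists [::]; rewrite big_nil. Qed.

Lemma reduced_spanM_vars (J : pred 'I_n) (g f : {mpoly k[n]}) :
  (forall i, J i -> forall h, reduced_span h -> reduced_span ('X_i * h)) ->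
  (forall m, m \in msupp g -> forall i, m i != 0%N -> J i) ->
  reduced_span f -> reduced_span (g * f).
Proof.
move=> JX gJ fS; rewrite [g]mpolyE mulr_suml big_seq.
apply: big_rec => [|m h mg hS]; first exact: reduced_span0.
apply: reduced_spanD => //; rewrite -scalerAl; apply: reduced_spanZ.
rewrite mpolyXE_id; elim/big_rec: _ => [|i h' _ h'S]; first by rewrite mul1r.
rewrite -mulrA; have [-> | mi] := eqVneq (m i) 0%N; first by rewrite mul1r.
elim: (m i) => [|a IHa]; first by rewrite mul1r.
by rewrite exprS -mulrA; apply: JX => //; apply: gJ mi.
Qed.

(** Where multiplication by 'X_i raises an exponent to p, replace 'X_i ^+ p by
   tau i + 'X_i + u i; the variables of u i have larger indices, so descending
   induction on i applies. *)
Lemma reduced_spanX i f : reduced_span f -> reduced_span ('X_i * f).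
Proof.
elim/ord_descending_ind: i f => i IHi f [s ->]; rewrite mulr_sumr.
elim/big_rec: _ => [|[c e] h _ hS]; first exact: reduced_span0.
apply: reduced_spanD => //; rewrite mulrCA; apply: reduced_span_tau => /=.
pose upd (a : 'I_p) : {ffun 'I_n -> 'I_p} := [ffun j => if j == i then a else e j].
have updE a : reduced_monomial (upd a) = 'X_i ^+ a * \prod_(j < n | j != i) 'X_j ^+ e j.
  rewrite /reduced_monomial (bigD1 i) //= ffunE eqxx; congr (_ * _).
  by apply: eq_bigr => j /negPf ji; rewrite ffunE ji.
have updSE (a b : 'I_p) : b = a.+1 :> nat ->
    reduced_monomial (upd b) = 'X_i * reduced_monomial (upd a).
  by move=> eqb; rewrite !updE eqb exprS mulrA.
have -> : e = upd (e i) by apply/ffunP => j; rewrite ffunE; case: eqP => [->|].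
have := ltn_ord (e i); rewrite leq_eqVlt => /orP[/eqP eip | eip]; last first.
  by rewrite -(updSE _ (Ordinal eip)) //; apply: reduced_span_monomial.
pose o0 := Ordinal (ltnW p_gt1); pose o1 := Ordinal p_gt1.
have -> : 'X_i * reduced_monomial (upd (e i))
    = (tau i + 'X_i + u i) * reduced_monomial (upd o0).
  rewrite /tau /artin_schreier addrAC !subrK.
  by rewrite !updE mul1r mulrA -exprS eip.
rewrite (mulrDl _ (u i)) (mulrDl (tau i)) -(updSE o0 o1) //.
apply: reduced_spanD; first apply: reduced_spanD.

- by rewrite -(pevalXU tau i); apply/reduced_span_tau/reduced_span_monomial.
- exact: reduced_span_monomial.
apply: (@reduced_spanM_vars (fun j => i < j)%N) => //; last first.
  exact: reduced_span_monomial.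
by move=> m mu j; rewrite ltnNge; apply: contra => ji; apply/eqP/(u_above mu).
Qed.

Lemma reduced_span_all f : reduced_span f.
Proof.
rewrite -[f]mulr1; apply: (@reduced_spanM_vars predT) => // [i _|].
  exact: reduced_spanX.
have := reduced_span_monomial [ffun=> Ordinal (ltnW p_gt1)].
by rewrite /reduced_monomial big1 // => i _; rewrite ffunE.
Qed.

End ArtinSchreier.

(** * Traces over translations and triangular models *)

Lemma lrmorph_horner_alg (k : fieldType) (A B : comAlgType k)
    (phi : {lrmorphism A -> B}) a q :
  phi (horner_alg a q) = horner_alg (phi a) q.
Proof.
elim/poly_ind: q => [|q c IHq]; first by rewrite !rmorph0.
rewrite !rmorphD !rmorphM /= IHq !horner_algX !horner_algC.
by rewrite linearZ /= rmorph1.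
Qed.

Section TranslationTrace.

Variables (k : fieldType) (p : nat) (char_k : p \in [pchar k]).
Implicit Types (q : {poly k}) (a : k).

Let p_gt0 : (0 < p)%N := prime_gt0 (pcharf_prime char_k).

Definition translation_trace q a : Prop :=
  \sum_(c < p) (q \Po ('X + c%:R%:P)) = a%:P.

Lemma natr_expp (c : nat) : (c%:R : k) ^+ p = c%:R.
Proof. by rewrite -(pFrobenius_autE char_k) pFrobenius_aut_nat. Qed.

Lemma sum_translate (V : nmodType) (F : nat -> V) : F p = F 0%N ->
  \sum_(c < p) F c.+1 = \sum_(c < p) F c.
Proof.
move: p_gt0; case: p => // d _ FE; rewrite big_ord_recr [RHS]big_ord_recl /=.
by rewrite FE addrC.
Qed.

Lemma translation_trace_alg (A : comAlgType k) (x : A) q a :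
  translation_trace q a -> \sum_(c < p) horner_alg (x + c%:R) q = a%:A.
Proof.
move/(congr1 (horner_alg x)); rewrite horner_algC rmorph_sum => <- /=.
apply: eq_bigr => c _.
rewrite -(scaler_nat c 1); elim/poly_ind: q => [|q d IHq]; first by rewrite !rmorph0.
rewrite comp_polyD comp_polyM comp_polyX comp_polyC !rmorphD !rmorphM /= IHq.
by rewrite rmorphD /= !horner_algX !horner_algC.
Qed.

(** The sum is a polynomial invariant under translation by 1 whose degree is
   less than p, hence takes its value at 0 at the p points of the prime field
   and is constant. *)
Lemma translation_trace_small q : (size q <= p)%N ->
  translation_trace q (\sum_(c < p) q.[c%:R]).
Proof.
move=> qp; rewrite /translation_trace; set S := \sum_(c < p) (_ \Po _).
set a := \sum_(c < p) _.
have SE (d : nat) : S.[d%:R] = a.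
  rewrite /S horner_sum; under eq_bigr do
    rewrite horner_comp hornerD hornerX hornerC addrC.
  elim: d => [|d IHd]; first by under eq_bigr do rewrite addr0.
  rewrite -IHd -(sum_translate (F := fun c => q.[c%:R + d%:R])).
    by apply: eq_bigr => c _; rewrite -!natrD addnS addSn.
  by rewrite (pcharf0 char_k).
apply/eqP; rewrite -subr_eq0; apply: contraT => nz.
have size_S : (size (S - a%:P)%R <= p)%N.
  rewrite (leq_trans (size_polyD _ _)) // size_polyN geq_max; apply/andP; split.
    apply: (leq_trans (size_sum _ _ _)); apply/bigmax_leqP => c _.
    by rewrite size_comp_poly2 // size_XaddC.
  exact: leq_trans (size_polyC_leq1 a) p_gt0.
have := @max_poly_roots _ (S - a%:P) [seq (c%:R : k) | c <- iota 0 p] nz.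
rewrite size_map size_iota ltnNge size_S; apply.
  by apply/allP => _ /mapP[c _ ->]; rewrite rootE !hornerE SE subrr.
rewrite map_inj_in_uniq ?iota_uniq // => c d; rewrite !mem_iota /= => cp dp.
wlog cd : c d cp dp / (c <= d)%N => [IH|].
  by case/orP: (leq_total c d) => [/IH|/IH IHd /esym/IHd->] //; apply.
move/eqP; rewrite eq_sym -subr_eq0 -natrB // -(dvdn_pcharf char_k).
rewrite /dvdn modn_small ?subn_eq0 => [dc|]; last exact: leq_ltn_trans (leq_subr _ _) dp.
by apply/eqP; rewrite eqn_leq cd.
Qed.

Lemma translation_trace_delta : translation_trace (1 - 'X^(p.-1)) 1.
Proof.
have szq : (size (1 - 'X^(p.-1) : {poly k})%R <= p)%N.
  rewrite (leq_trans (size_polyD _ _)) // size_polyN size_poly1 size_polyXn prednK //.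
  by rewrite geq_max p_gt0 leqnn.
have := translation_trace_small szq; congr translation_trace.
rewrite (bigD1 (Ordinal p_gt0)) //= big1 => [|c c0].
  rewrite !hornerE expr0n eqn0Ngt -ltnS prednK //.
  by rewrite (prime_gt1 (pcharf_prime char_k)) ?subr0 ?addr0.
have nz_c : c%:R != 0 :> k.
  by rewrite -(dvdn_pcharf char_k) gtnNdvd // lt0n.
rewrite !hornerE; apply/eqP; rewrite subr_eq0; apply/eqP/(mulfI nz_c).
by rewrite -exprS prednK // natr_expp mulr1.
Qed.

Lemma translation_trace_mul_delta : translation_trace ('X * (1 - 'X^(p.-1))) 0.
Proof.
have char_P : p \in [pchar {poly k}] by rewrite pchar_poly.
rewrite /translation_trace mulrBr mulr1 -exprS prednK //.
transitivity (\sum_(c < p) ('X - 'X^p : {poly k})).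
  apply: eq_bigr => c _; rewrite comp_polyB comp_Xn_poly comp_polyX.
  rewrite -(pFrobenius_autE char_P) rmorphD /= !pFrobenius_autE.
  by rewrite -polyC_exp natr_expp opprD addrACA subrr addr0.
by rewrite sumr_const card_ord -mulr_natl (pcharf0 char_P) mul0r.
Qed.

End TranslationTrace.

(** A right action of G on k['X_0, ..., 'X_(n-1)], given by the images L g i of
   the variables. The trace condition on products of one-variable polynomials
   and the Artin-Schreier invariants are what the inductive construction
   carries along; everything else follows from them. *)
Record triangular_model (k : fieldType) (p n : nat) (G : finGroupType)
    (L : G -> 'I_n -> {mpoly k[n]}) : Prop := TriangularModel {
  model1 : forall i, L 1%g i = 'X_i;
  modelM : forall g h i, L (g * h)%g i = peval (L h) (L g i);
  model_above : forall g i, mvars_above i (L g i - 'X_i);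
  model_trace : forall (q : 'I_n -> {poly k}) (a : 'I_n -> k),
    (forall i, translation_trace p (q i) (a i)) ->
    \sum_g peval (L g) (\prod_i horner_alg 'X_i (q i)) = (\prod_i a i)%:A;
  model_invariants : exists2 u : 'I_n -> {mpoly k[n]},
    forall i, mvars_above i (u i) &
    forall g i, peval (L g) (artin_schreier p u i) = artin_schreier p u i }.

Section ModelTheory.

Variables (k : fieldType) (p n : nat) (G : finGroupType).
Variable L : G -> 'I_n -> {mpoly k[n]}.
Hypotheses (char_k : p \in [pchar k]) (ML : triangular_model p L).

Definition model_shift g i := L g i - 'X_i.

Lemma peval_modelM g h f : peval (L (g * h)%g) f = peval (L h) (peval (L g) f).
Proof. by rewrite peval_peval; apply: eq_peval => i; rewrite (modelM ML). Qed.

Lemma model_shiftM g h i :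
  model_shift (g * h)%g i = peval (L h) (model_shift g i) + model_shift h i.
Proof.
rewrite /model_shift (modelM ML) rmorphB /= pevalXU.
by rewrite addrA subrK.
Qed.

(** On points with coordinates in the prime field this is the indicator
   function of the origin. *)
Definition model_delta : {mpoly k[n]} :=
  \prod_i horner_alg 'X_i (1 - 'X^(p.-1)).

Lemma trace_model_delta : \sum_g peval (L g) model_delta = 1.
Proof.
rewrite (model_trace ML (a := fun=> 1)) => [|i].
  by rewrite big1 ?scale1r.
exact: translation_trace_delta.
Qed.

Lemma trace_model_mul_delta i : \sum_g peval (L g) ('X_i * model_delta) = 0.
Proof.
pose q j : {poly k} :=
  if j == i then 'X * (1 - 'X^(p.-1)) else 1 - 'X^(p.-1).
have -> : 'X_i * model_delta = \prod_j horner_alg 'X_j (q j).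
  rewrite /model_delta (bigD1 i) //= [RHS](bigD1 i) //= /q eqxx.
  rewrite (rmorphM _ 'X) /= horner_algX mulrA.
  by congr (_ * _); apply: eq_bigr => j /negPf->.
rewrite (model_trace ML (a := fun j => (j != i)%:R)) => [|j].
  by rewrite (bigD1 i) //= eqxx mul0r scale0r.
rewrite /q; case: eqP => _; first exact: translation_trace_mul_delta.
exact: translation_trace_delta.
Qed.

(** Both traces of this section in one formula, in the form in which it shows
   that a cocycle splitting built with model_delta recovers 'X_i. *)
Lemma sum_shift_delta i :
  \sum_g model_shift g i * peval (L g) model_delta = - 'X_i.
Proof.
under eq_bigr do rewrite mulrBl.
rewrite sumrB -mulr_sumr trace_model_delta mulr1.
rewrite [X in X - _](_ : _ = \sum_g peval (L g) ('X_i * model_delta)).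
  by rewrite trace_model_mul_delta sub0r.
by apply: eq_bigr => g _; rewrite rmorphM /= pevalXU.
Qed.

(** An invariant f is the trace of f * model_delta, the trace is linear over
   the Artin-Schreier invariants, and it maps each reduced monomial to a
   scalar. *)
Lemma model_invariant_generators :
  exists tau : 'I_n -> {mpoly k[n]}, injective (peval tau) /\
    forall f, (forall g, peval (L g) f = f) <-> exists h, f = peval tau h.
Proof.
have [u u_above u_inv] := model_invariants ML.
have p_gt1 := prime_gt1 (pcharf_prime char_k).
exists (artin_schreier p u); split=> [|f]; first exact: artin_schreier_independent.
have tau_inv h g : peval (L g) (peval (artin_schreier p u) h)
    = peval (artin_schreier p u) h.
  by rewrite peval_peval; apply: eq_peval => i; rewrite u_inv.
split=> [f_inv | [h ->] g]; last exact: tau_inv.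
have [s sE] := reduced_span_all p_gt1 u_above (f * model_delta).
have -> : f = \sum_g peval (L g) (f * model_delta).
  under eq_bigr do rewrite rmorphM /= f_inv.
  by rewrite -mulr_sumr trace_model_delta mulr1.
pose t (e : {ffun 'I_n -> 'I_p}) : k := \prod_i \sum_(c < p) ('X^(e i)).[c%:R].
exists (\sum_(c <- s) t c.2 *: c.1).
rewrite sE; under eq_bigr do rewrite rmorph_sum.
rewrite exchange_big rmorph_sum; apply: eq_bigr => c _ /=.
under eq_bigr do rewrite rmorphM /= tau_inv.
rewrite -mulr_sumr linearZ /=.
have -> : reduced_monomial k c.2 = \prod_i horner_alg 'X_i 'X^(c.2 i).
  by apply: eq_bigr => i _; rewrite rmorphXn /= horner_algX.
rewrite (model_trace ML (a := fun i => \sum_(d < p) ('X^(c.2 i)).[d%:R])).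
  by rewrite -scalerAr mulr1.
move=> i; apply: translation_trace_small; rewrite // size_polyXn.
exact: ltn_ord.
Qed.

End ModelTheory.

(** * Existence of triangular models *)

Section CentralExtension.

Variables (k : fieldType) (p n : nat) (G : finGroupType) (z : G).
Hypotheses (char_k : p \in [pchar k]) (ord_z : #[z]%g = p).
Hypothesis z_central : z \in 'Z([set: G])%g.

Local Notation Z := <[z]>%g.
Local Notation H := (coset_of Z).
Local Notation cos := (coset Z).

Let zC m g : (g * z ^+ m = z ^+ m * g)%g.
Proof. by have [_ zc] := centerP _ _ z_central; apply/commuteX/commute_sym/zc. Qed.

Let norm_Z g : g \in 'N(Z)%g.
Proof.
have /normal_norm/subsetP : (Z <| [set: G])%g.
  by apply: sub_center_normal; rewrite cycle_subG.
by apply; rewrite inE.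
Qed.

Let cosM g h : cos (g * h)%g = (cos g * cos h)%g.
Proof. by rewrite morphM ?norm_Z. Qed.

Let cos_expz m : cos (z ^+ m)%g = 1%g.
Proof. by rewrite coset_id // mem_cycle. Qed.

Let cos_zl m g : cos (z ^+ m * g)%g = cos g.
Proof. by rewrite cosM cos_expz mul1g. Qed.

Let cos_eq g h : cos g = cos h -> exists m, g = (z ^+ m * h)%g.
Proof.
move=> /(kercoset_rcoset (norm_Z g) (norm_Z h))[_ /cycleP[m ->] ->].
by exists m.
Qed.

Let expz_mod m m' : (z ^+ m)%g = (z ^+ m')%g -> m%:R = m'%:R :> k.
Proof.
move/eqP; rewrite eq_expg_mod_order ord_z => /eqP mm'.
by rewrite -(GRing.natr_mod_pchar char_k) mm' GRing.natr_mod_pchar.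
Qed.

Let section_bij : bijective (fun x : H * 'I_p => (z ^+ x.2 * repr x.1)%g).
Proof.
have p_gt0 := prime_gt0 (pcharf_prime char_k).
have split_g g : exists m : 'I_p, g = (z ^+ m * repr (cos g))%g.
  have [|m gE] := @cos_eq g (repr (cos g)); first by rewrite coset_reprK.
  exists (Ordinal (ltn_pmod m p_gt0)).
  by rewrite /= -[in (_ %% _)%N]ord_z expg_mod_order -gE.
have [m gE] := choice split_g.
exists (fun g => (cos g, m g)) => [[u a] | g]; last by rewrite /= -gE.
have cosE : cos (z ^+ a * repr u)%g = u by rewrite cos_zl coset_reprK.
rewrite /= cosE; congr (_, _); apply: val_inj => /=.
have /eqP := gE (z ^+ a * repr u)%g; rewrite cosE (inj_eq (mulIg _)).
by rewrite eq_expg_mod_order ord_z !modn_small // => /eqP.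
Qed.

Lemma card_central_quotient : #|G| = (#|{: H}| * p)%N.
Proof. by rewrite -(bij_eq_card section_bij) card_prod card_ord. Qed.

Let sum_section (V : nmodType) (F : G -> V) :
  \sum_g F g = \sum_(u : H) \sum_(m < p) F (z ^+ m * repr u)%g.
Proof.
by rewrite (reindex _ (onW_bij _ section_bij)) pair_bigA.
Qed.

Let zinv_repr (T : Type) (F : G -> T) : (forall m g, F (z ^+ m * g)%g = F g) ->
  forall u g, F (repr (u * cos g)%g) = F (repr u * g)%g.
Proof.
move=> FP u g; have [|m ->] := @cos_eq (repr (u * cos g)%g) (repr u * g)%g.
  by rewrite cosM !coset_reprK.
exact: FP.
Qed.

Let exists_chi : exists chi : G -> k, forall m g,
  chi (z ^+ m * g)%g = m%:R + chi g.
Proof.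
have split_g g : exists m, g = (z ^+ m * repr (cos g))%g.
  by apply: cos_eq; rewrite coset_reprK.
have [c cE] := choice split_g; exists (fun g => (c g)%:R) => m g.
rewrite -natrD; apply: expz_mod; apply: (@mulIg _ (repr (cos g))).
by rewrite expgD -mulgA -cE -(cos_zl m g) -cE.
Qed.

Variable L' : H -> 'I_n -> {mpoly k[n]}.
Hypothesis ML' : triangular_model p L'.

Local Notation act' g := (peval (L' (cos g))).
Local Notation delta := (model_delta k p n).

Let sum_delta g : \sum_(u : H) peval (L' (u * cos g)%g) delta = 1.
Proof.
rewrite -(trace_model_delta char_k ML').
by rewrite [RHS](reindex_inj (mulIg (cos g))).
Qed.

(** The polynomials in the old variables being acyclic over H, the
   homomorphism z ^+ m |-> m extends to a cocycle of G with values in them: a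
   set-theoretic extension chi is averaged with weights model_delta. *)
Let exists_cocycle : exists Phi : G -> {mpoly k[n]},
  (forall g h, Phi (g * h)%g = act' h (Phi g) + Phi h) /\
  (forall m g, Phi (z ^+ m * g)%g = m%:R + Phi g).
Proof.
have [chi chiE] := exists_chi.
pose Phi g := \sum_(u : H)
  (chi (repr u * g)%g - chi (repr u)) *: peval (L' (u * cos g)%g) delta.
exists Phi; split=> [g h | m g].
  have -> : Phi h = \sum_(u : H)
      (chi (repr u * g * h)%g - chi (repr u * g)%g)
        *: peval (L' (u * cos g * cos h)%g) delta.
    rewrite [LHS](reindex_inj (mulIg (cos g))); apply: eq_bigr => u _ /=.
    congr (_ *: _).
    apply: (@zinv_repr _ (fun x => chi (x * h)%g - chi x)) => m x.
    by rewrite -mulgA !chiE opprD addrACA subrr add0r.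
  rewrite rmorph_sum -big_split; apply: eq_bigr => u _ /=.
  rewrite linearZ /= -(peval_modelM ML') -scalerDl cosM !mulgA.
  by congr (_ *: _); rewrite [RHS]addrC addrA subrK.
rewrite -{1}(scaler_nat m) -{1}(sum_delta g) scaler_sumr -big_split.
apply: eq_bigr => u _ /=; rewrite -scalerDl cos_zl; congr (_ *: _).
by rewrite mulgA zC -mulgA chiE addrA.
Qed.

(** Phi ^+ p - Phi takes the value 0 on the powers of z and is therefore a
   cocycle of H, where every cocycle splits. Subtracting v from 'X ^+ p - 'X in
   the new variable then gives an invariant. *)
Let exists_invariant_correction (Phi : G -> {mpoly k[n]}) :
  (forall g h, Phi (g * h)%g = act' h (Phi g) + Phi h) ->
  (forall m g, Phi (z ^+ m * g)%g = m%:R + Phi g) ->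
  exists v, forall g, act' g v = v + (Phi g ^+ p - Phi g).
Proof.
move=> PhiM Phiz; pose d g := Phi g ^+ p - Phi g.
have char_B : p \in [pchar {mpoly k[n]}].
  by rewrite (rmorph_pchar (in_alg {mpoly k[n]})).
have FrobD (a b : {mpoly k[n]}) : (a + b) ^+ p = a ^+ p + b ^+ p.
  by rewrite -!(pFrobenius_autE char_B) rmorphD.
have dz m g : d (z ^+ m * g)%g = d g.
  rewrite /d Phiz FrobD -(scaler_nat m) exprZn expr1n (natr_expp char_k).
  by rewrite opprD addrACA subrr add0r.
have dM g h : act' h (d g) = d (g * h)%g - d h.
  by rewrite /d PhiM FrobD opprD addrACA addrK rmorphB rmorphXn.
exists (- \sum_(u : H) d (repr u) * peval (L' u) delta) => g.
rewrite rmorphN rmorph_sum /= -/(d g) -[d g]mulr1 -(sum_delta g) mulr_sumr.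
rewrite [X in _ = - X + _](reindex_inj (mulIg (cos g))) /= -!sumrN -big_split.
apply: eq_bigr => u _; rewrite rmorphM /= -(peval_modelM ML') zinv_repr //.
by rewrite dM mulrBl opprB addrC.
Qed.

Local Notation lift0 := (peval (fun j : 'I_n => 'X_(lift ord0 j) : {mpoly k[n.+1]})).

Lemma above_lift0 f : mvars_above ord0 (lift0 f).
Proof. by apply: mvars_above_peval => e _ j _; apply: mvars_aboveX. Qed.

Lemma above_lift i f : mvars_above i f -> mvars_above (lift ord0 i) (lift0 f).
Proof.
move=> fP; apply: mvars_above_peval => e ef j ej; apply: mvars_aboveX.
rewrite /= /bump /= !add1n ltnS ltnNge; apply: contra ej => ji.
by rewrite (fP _ ef).
Qed.

(** The new variable is translated by a cocycle that restricts to
   z ^+ m |-> m on the central subgroup. *)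
Lemma triangular_model_extension :
  exists L : G -> 'I_n.+1 -> {mpoly k[n.+1]}, triangular_model p L.
Proof.
have [Phi [PhiM Phiz]] := exists_cocycle.
have [v vP] := exists_invariant_correction PhiM Phiz.
have [L [L0 LS]] : exists L : G -> 'I_n.+1 -> {mpoly k[n.+1]},
    (forall g, L g ord0 = 'X_ord0 + lift0 (Phi g)) /\
    (forall g j, L g (lift ord0 j) = lift0 (L' (cos g) j)).
  exists (fun g i => if unlift ord0 i is Some j then lift0 (L' (cos g) j)
                     else 'X_i + lift0 (Phi g)).
  by split=> g => [|j]; rewrite ?unlift_none ?liftK.
have L_lift g f : peval (L g) (lift0 f) = lift0 (act' g f).
  rewrite !peval_peval; apply: eq_peval => j; rewrite pevalXU LS.
  by [].
have LM g h i : L (g * h)%g i = peval (L h) (L g i).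
  have [j -> | ->] := unliftP ord0 i.
    by rewrite !LS L_lift cosM (modelM ML').
  rewrite !L0 PhiM !rmorphD /= pevalXU L_lift L0 -addrA; congr (_ + _).
  exact: addrC.
have peval_LM g h f : peval (L (g * h)%g) f = peval (L h) (peval (L g) f).
  by rewrite peval_peval; apply: eq_peval => i; apply: LM.
have act_id f : act' 1%g f = f.
  rewrite -[RHS]peval_id; apply: eq_peval => i.
  by rewrite coset_id ?group1 // (model1 ML').
have Phi1 : Phi 1%g = 0.
  by apply: (addIr (Phi 1%g)); rewrite -{1}[Phi 1%g]act_id -PhiM mulg1 add0r.
exists L; split=> [i | // | g i | q a qa |].
- have [j -> | ->] := unliftP ord0 i.
    by rewrite LS coset_id ?group1 // (model1 ML') pevalXU.
  by rewrite L0 Phi1 rmorph0 addr0.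
- have [j -> | ->] := unliftP ord0 i.
    have := above_lift (@model_above _ _ _ _ _ ML' (cos g) j).
    by rewrite rmorphB /= pevalXU LS.
  by rewrite L0 addrC addKr; apply: above_lift0.
- pose Q : {mpoly k[n]} := \prod_j horner_alg 'X_j (q (lift ord0 j)).
  have prodE : \prod_i horner_alg 'X_i (q i)
      = horner_alg 'X_ord0 (q ord0) * lift0 Q.
    rewrite big_ord_recl rmorph_prod; congr (_ * _).
    by apply: eq_bigr => j _ /=; rewrite lrmorph_horner_alg /= pevalXU.
  have act_new m : peval (L (z ^+ m)%g) (horner_alg 'X_ord0 (q ord0))
      = horner_alg ('X_ord0 + m%:R) (q ord0).
    have -> : 'X_ord0 + m%:R = peval (L (z ^+ m)%g) 'X_ord0.
      rewrite pevalXU L0 -[(z ^+ m)%g]mulg1 Phiz Phi1 addr0.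
      by rewrite rmorph_nat.
    exact: (lrmorph_horner_alg (peval (L (z ^+ m)%g))).
  have act_old m : peval (L (z ^+ m)%g) (lift0 Q) = lift0 Q.
    by rewrite L_lift cos_expz -(cos_expz 0) act_id.
  rewrite sum_section prodE.
  transitivity (\sum_(u : H) peval (L (repr u)) (a ord0 *: lift0 Q)).
    apply: eq_bigr => u _.
    transitivity (\sum_(m < p) peval (L (repr u))
        (horner_alg ('X_ord0 + m%:R) (q ord0) * lift0 Q)).
      by apply: eq_bigr => m _; rewrite peval_LM rmorphM /= act_new act_old.
    rewrite -rmorph_sum -mulr_suml /= (translation_trace_alg _ (qa ord0)).
    by rewrite -scalerAl mul1r.
  transitivity (\sum_(u : H) a ord0 *: lift0 (peval (L' u) Q)).
    by apply: eq_bigr => u _; rewrite linearZ /= L_lift coset_reprK.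
  rewrite -scaler_sumr -rmorph_sum /= (model_trace ML' (a := fun j => a (lift ord0 j))) //.
  by rewrite linearZ /= rmorph1 scalerA [in RHS]big_ord_recl.
have [u' u'_above u'_inv] := model_invariants ML'.
pose u i : {mpoly k[n.+1]} :=
  if unlift ord0 i is Some j then lift0 (u' j) else lift0 v.
exists u => [i | g i].
  rewrite /u; case: unliftP => [j -> | ->]; last exact: above_lift0.
  exact: above_lift.
rewrite /artin_schreier /u; case: unliftP => [j -> | ->].
  have -> : 'X_(lift ord0 j) ^+ p - 'X_(lift ord0 j) - lift0 (u' j)
      = lift0 (artin_schreier p u' j).
    by rewrite !rmorphB rmorphXn /= pevalXU.
  by rewrite L_lift u'_inv.
have char_B : p \in [pchar {mpoly k[n.+1]}].
  by rewrite (rmorph_pchar (in_alg {mpoly k[n.+1]})).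
rewrite !rmorphB rmorphXn /= pevalXU L_lift vP L0.
rewrite -(pFrobenius_autE char_B) rmorphD /= !pFrobenius_autE.
rewrite rmorphD rmorphB rmorphXn /=.
by ring.
Qed.

End CentralExtension.

Lemma triangular_model_exists (k : fieldType) (p n : nat) (G : finGroupType) :
  p \in [pchar k] -> #|G| = (p ^ n)%N ->
  exists L : G -> 'I_n -> {mpoly k[n]}, triangular_model p L.
Proof.
move=> char_k; have p_prime := pcharf_prime char_k.
elim: n G => [|n IHn] G cardG.
  have G1 (g : G) : g = 1%g by apply: (fintype_le1P (eq_leq cardG)).
  exists (fun g i => 'X_i); split=> [//|g h i|g i|q a qa|]; try by case: i.
    rewrite !big_ord0 (big_pred1 1%g) ?rmorph1 ?scale1r // => g.
    by rewrite /= [g]G1 eqxx.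
  by exists (fun=> 0) => [|g] [].
have G_pgroup : (p.-group [set: G])%g by rewrite /pgroup cardsT cardG pnatX pnat_id.
have ntG : [set: G]%g != 1%g.
  by rewrite -cardG_gt1 cardsT cardG (ltn_exp2l 0) // prime_gt1.
have [x xZ ord_x] : {x | x \in 'Z([set: G])%g & #[x]%g = p}.
  apply: Cauchy => //; have := center_nil_eq1 (pgroup_nil G_pgroup).
  rewrite (negPf ntG) => /negbT; rewrite trivg_card1.
  have : (p.-group 'Z([set: G]))%g := pgroupS (center_sub _) G_pgroup.
  by case/p_natP => // [[|m]] -> //; rewrite expnS dvdn_mulr.
have cardH : #|{: coset_of <[x]>}| = (p ^ n)%N.
  apply/eqP; rewrite -(eqn_pmul2r (prime_gt0 p_prime)) -expnSr -cardG.
  by rewrite (card_central_quotient char_k ord_x xZ).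
have [L' ML'] := IHn _ cardH.
exact: triangular_model_extension ML'.
Qed.

(** * Equivariant maps from a model to an algebra with an element of trace 1 *)

Lemma total_actM (G : finGroupType) (T : Type) (to : {action G &-> T}) x g h :
  to x (g * h)%g = to (to x g) h.
Proof. by case: to => f [f_inj fM] /=; apply: fM; rewrite inE. Qed.

Section Versality.

Variables (k : fieldType) (p n : nat) (G : finGroupType).
Variable L : G -> 'I_n -> {mpoly k[n]}.
Hypothesis ML : triangular_model p L.
Variables (A : comAlgType k) (to : {action G &-> A}).
Hypothesis toA : Galgebra_action to.

(** The hypothesis is an argument so that the morphism structures, which depend
   on it, can be attached to this name. *)
Definition act_by (_ : Galgebra_action to) g (x : A) : A := to x g.

HB.instance Definition _ g :=
  GRing.isLinear.Build k A A *:%R (act_by toA g) (toA g).1.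
HB.instance Definition _ g :=
  GRing.isMonoidMorphism.Build A A (act_by toA g) (toA g).2.

Lemma act_peval m (Y : 'I_m -> A) f g :
  to (peval Y f) g = peval (fun i => to (Y i) g) f.
Proof. exact: (lrmorph_peval (act_by toA g)). Qed.

(** Each y i splits the cocycle by which 'X_i is translated, with the standard
   formula for a splitting in an algebra that has an element of trace 1. *)
Lemma model_versal (a : A) : transfer to a = 1 ->
  exists y : 'I_n -> A,
    (forall i, y i = - \sum_h peval y (model_shift L h i) * to a h) /\
    (forall g f, to (peval y f) g = peval y (peval (L g) f)).
Proof.
move=> tr_a.
have [y yE] := triangular_fixpoint (0 : A)
  (F := fun i y => - \sum_h peval y (model_shift L h i) * to a h)
  (fun i y z yz => congr1 -%R (eq_bigr _ (fun h _ =>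
     congr1 ( *%R^~ (to a h)) (peval_above (@model_above _ _ _ _ _ ML h i) yz)))).
exists y; split=> // g f; rewrite act_peval peval_peval; apply: eq_peval => i.
elim/ord_descending_ind: i => i IHi.
have to_shift h : to (peval y (model_shift L h i)) g
    = peval y (model_shift L (h * g)%g i) - peval y (model_shift L g i).
  rewrite (model_shiftM ML) [X in _ = X - _]rmorphD /= addrK act_peval [RHS]peval_peval.
  exact: peval_above (@model_above _ _ _ _ _ ML h i) IHi.
have -> : peval y (L g i) = y i + peval y (model_shift L g i).
  by rewrite /model_shift rmorphB /= pevalXU addrC subrK.
rewrite {1}yE [X in X + _]yE -/(act_by toA g _) rmorphN rmorph_sum /=.
rewrite -[peval y (model_shift L g i)]mulr1 -tr_a /transfer mulr_sumr.
rewrite ![\sum_h _ * to a h](reindex_inj (mulIg g)) /= -!sumrN -big_split.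
apply: eq_bigr => h _; rewrite rmorphM /= /act_by to_shift -total_actM.
by rewrite mulrBl opprB addrC.
Qed.

End Versality.

Lemma comp_mpoly_peval (k : fieldType) m n (f : {mpoly k[n]})
    (t : n.-tuple {mpoly k[m]}) : f \mPo t = peval (tnth t) f.
Proof.
rewrite /comp_mpoly /peval /mmap; apply: eq_bigr => e _.
by rewrite mul_mpolyC -scalerAl mul1r.
Qed.

Section UniversalProperty.

Variables (k : fieldType) (G : finGroupType) (B : comAlgType k).
Variable b : G -> B.
Hypothesis sum_b : \sum_g b g = 1.

(** D_k is the universal commutative algebra with a family indexed by G whose
   sum is 1. As for act_by, the hypothesis is an argument for the sake of the
   morphism structures. *)
Definition Dk_map (_ : \sum_g b g = 1) (x : Dk k G) : B :=
  peval (b \o enum_val) (Drepr x).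

Lemma Dk_map_pi f : Dk_map sum_b (Dpi f) = peval (b \o enum_val) f.
Proof.
have /eqP/DpiP[q e] := DreprK (Dpi f).
apply/eqP; rewrite -subr_eq0 /Dk_map -rmorphB e rmorphM /=.
rewrite [peval _ (alpha k G)](_ : _ = 0) ?mulr0 //.
rewrite /alpha rmorphD rmorphN rmorph1 rmorph_sum /= -sum_b addrC.
apply/eqP; rewrite subr_eq0; apply/eqP/eq_bigr => g _.
by rewrite pevalXU /= enum_rankK.
Qed.

Fact Dk_map_is_linear : linear (Dk_map sum_b).
Proof.
move=> c x y; rewrite -(DreprK x) -(DreprK y) [_ *: Dpi _]Dk_scale_pi.
by rewrite -rmorphD !Dk_map_pi linearP.
Qed.

Fact Dk_map_is_monoid_morphism : monoid_morphism (Dk_map sum_b).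
Proof.
split=> [|x y]; first by rewrite -(rmorph1 (@Dpi k G)) Dk_map_pi rmorph1.
by rewrite -(DreprK x) -(DreprK y) -rmorphM !Dk_map_pi rmorphM.
Qed.

HB.instance Definition _ :=
  GRing.isLinear.Build k (Dk k G) B *:%R (Dk_map sum_b) Dk_map_is_linear.
HB.instance Definition _ :=
  GRing.isMonoidMorphism.Build (Dk k G) B (Dk_map sum_b)
    Dk_map_is_monoid_morphism.

Lemma Dk_map_xgen g : Dk_map sum_b (xgen k g) = b g.
Proof. by rewrite Dk_map_pi pevalXU /= enum_rankK. Qed.

Lemma Dk_map_equivariant (phi : {lrmorphism B -> B}) h :
  (forall g, phi (b g) = b (g * h)%g) ->
  forall x, Dk_map sum_b (Dk_act k G x h) = phi (Dk_map sum_b x).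
Proof.
move=> phib x; rewrite -(DreprK x) /= Dk_act_pi !Dk_map_pi lrmorph_peval.
rewrite /Sym_act comp_mpoly_peval peval_peval; apply: eq_peval => i.
by rewrite tnth_mktuple pevalXU /= enum_rankK phib.
Qed.

End UniversalProperty.

Lemma transfer_xgen (k : fieldType) (G : finGroupType) :
  transfer (Dk_act k G) (xgen k 1%g) = 1.
Proof.
rewrite /transfer -(sum_xgen k G); apply: eq_bigr => g _.
by rewrite xgen_act mul1g.
Qed.

(** * The retract of D_k *)

Theorem theorem1p1 (k : fieldType) (p n : nat) (G : finGroupType)
    (char_k : p \in [pchar k]) (card_G : #|G| = (p ^ n)%N) :
  exists U : {pred Dk k G},
    [/\ Gsubalgebra (Dk_act k G) U,
        trace_surjective (Dk_act k G) U,
        [/\ polynomial_ring U, krull_dim U n & Gretract (Dk_act k G) U],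
        (exists Y : 'I_n -> Dk k G,
          polynomial_generators Y U /\ triangular_action (Dk_act k G) Y)
      &
        polynomial_ring (invariants_in (Dk_act k G) U)
        /\ krull_dim (invariants_in (Dk_act k G) U) n].

Proof.
have [L ML] := triangular_model_exists char_k card_G.
have [y [yE y_act]] := model_versal ML (@Dk_act_Galgebra k G) (transfer_xgen k G).
pose delta := model_delta k p n.
have sum_delta : \sum_g peval (L g) delta = 1 := trace_model_delta char_k ML.
pose theta := Dk_map sum_delta.
have theta_act g x : theta (Dk_act k G x g) = peval (L g) (theta x).
  apply: (Dk_map_equivariant sum_delta (phi := peval (L g))) => h.
  by rewrite /= -(peval_modelM ML).
(* theta inverts y on the later variables, so that the translation of y i by h
   is mapped to that of 'X_i. *)
have theta_y i : theta (y i) = 'X_i.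
  elim/ord_descending_ind: i => i IHi.
  rewrite yE /theta rmorphN rmorph_sum -[RHS]opprK.
  rewrite -(sum_shift_delta char_k ML); congr (- _); apply: eq_bigr => h _.
  rewrite xgen_act mul1g rmorphM /= Dk_map_xgen.
  congr (_ * _); rewrite lrmorph_peval -[RHS]peval_id.
  exact: peval_above (@model_above _ _ _ _ _ ML h i) IHi.
have thetaK f : theta (peval y f) = f.
  rewrite /theta lrmorph_peval -[RHS]peval_id; apply: eq_peval => i.
  exact: theta_y.
have y_inj : injective (peval y) := can_inj thetaK.
pose U : {pred Dk k G} := fun x => `[< exists f, x = peval y f >].
have UP x : reflect (exists f, x = peval y f) (x \in U) by exact: asboolP.
have Uy : polynomial_generators y U by split=> // x; split=> /UP.
have U_inv x : (x \in invariants_in (Dk_act k G) U) <->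
    exists2 f, x = peval y f & forall g, peval (L g) f = f.
  split=> [/andP[/UP[f ->] /forallP f_inv] | [f -> f_inv]].
    exists f => // g; apply: y_inj; rewrite -y_act.
    exact/eqP.
  apply/andP; split; first by apply/UP; exists f.
  by apply/forallP => g; rewrite y_act f_inv.
have [tau [tau_inj tauP]] := model_invariant_generators char_k ML.
have inv_gen : polynomial_generators (fun i => peval y (tau i))
    (invariants_in (Dk_act k G) U).
  split=> [f g | x].
    by rewrite -!peval_peval => /y_inj/tau_inj.
  split=> [/U_inv[_ -> /tauP[h ->]] | [h ->]].
    by exists h; rewrite peval_peval.
  apply/U_inv; exists (peval tau h); first by rewrite peval_peval.
  by apply/tauP; exists h.
exists U; split.
- split; first exact: polynomial_generators_subalg Uy.
  by move=> g _ /UP[f ->]; apply/UP; rewrite y_act; eexists.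
- move=> x; split=> [/U_inv[f -> f_inv] | [_ /UP[f ->] ->]].
    exists (peval y (f * delta)); first by apply/UP; eexists.
    rewrite /transfer; under eq_bigr do rewrite y_act rmorphM /= f_inv.
    by rewrite -rmorph_sum /= -mulr_sumr sum_delta mulr1.
  apply/U_inv; exists (\sum_g peval (L g) f).
    by rewrite rmorph_sum; apply: eq_bigr => g _; rewrite y_act.
  move=> g; rewrite rmorph_sum [RHS](reindex_inj (mulIg g)) /=.
  by apply: eq_bigr => h _; rewrite (peval_modelM ML).
- split; [by exists n, y | exact: krull_dim_polynomial Uy |].
  exists (fun x => theta x == 0); split.
  + split; first by rewrite unfold_in /theta rmorph0.
    move=> a u v; rewrite !unfold_in => /eqP u0 /eqP v0.
    by rewrite /theta rmorphD rmorphM /= -!/(theta _) u0 v0 mulr0 addr0.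
  + move=> g x; rewrite !unfold_in => /eqP x0.
    by rewrite theta_act x0 rmorph0.
  + split=> [x | _ /UP[f ->]]; last first.
      by rewrite unfold_in thetaK => /eqP->; rewrite rmorph0.
    exists (peval y (theta x)), (x - peval y (theta x)).
    split; [by apply/UP; eexists | | by rewrite addrC subrK].
    by rewrite unfold_in /theta rmorphB /= -!/(theta _) thetaK subrr.
- exists y; split=> // g i; exists (L g i - 'X_i).
    exact: (@model_above _ _ _ _ _ ML).
  by rewrite -[y i](pevalXU y) y_act pevalXU -rmorphD /= addrC subrK.
split; first by exists n; eexists; exact: inv_gen.
exact: krull_dim_polynomial inv_gen.
Qed.
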